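(* Suppose $(m,n)$ is a coprime pair of positive integers. Let $R=\{r_1,\dots,r_{m+n}\}$ be a set of $m+n$ (distinct) ranks with $0\in R$. Then the following statements are equivalent. \begin{enumerate} \item $R\in\mathfrak{R}_{m,n}$, i.e., $R$ is the rank set of an $(m,n)$-path $P$. \item If $\ell$ belongs to $R$ then at least one of $\ell+m$ and $\ell-n$ belongs to $R$. \item If $\ell\in R$ then exactly one of $\ell+m$ and $\ell-n$ belongs to $R$. \item If $\ell$ belongs to $R$ then at least one of $\ell-m$ and $\ell+n$ belongs to $R$. \item If $\ell\in R$ then exactly one of $\ell-m$ and $\ell+n$ belongs to $R$. \end{enumerate}
   Context: The rank of a lattice point $(a,b)$ is the integer $r(a,b)=mb-na$; a ''rank'' is an integer of this form (since $m,n$ are coprime, every integer is of this form). An $(m,n)$-path $P$ is a lattice path $P_0=(0,0),P_1,\dots,P_{m+n}=(m,n)$ in which each step $P_i-P_{i-1}$ is $(0,1)$ or $(1,0)$ (so $n$ up steps and $m$ east steps, with no further restriction). Its rank set is $R(P)=\{r(P_0),\dots,r(P_{m+n-1})\}$, a set of $m+n$ distinct integers. $\mathfrak{R}_{m,n}$ is the set of rank sets of all $(m,n)$-paths. *)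

(* Defs.v *)
From HB Require Import structures.
From mathcomp Require Import all_boot all_order all_algebra finmap.
Set Implicit Arguments.
Unset Strict Implicit.
Unset Printing Implicit Defensive.
Import Order.TTheory GRing.Theory Num.Theory.
Local Open Scope ring_scope.

Definition lattice_point : Type := (int * int)%type.

Definition rank (m n : nat) (p : lattice_point) : int :=
  m%:Z * p.2 - n%:Z * p.1.

Definition is_rank (m n : nat) (l : int) : Prop :=
  exists p : lattice_point, l = rank m n p.

Definition lattice_step : rel lattice_point :=
  fun p q => (q == (p.1, p.2 + 1)) || (q == (p.1 + 1, p.2)).

(* The list of vertices P_0, ..., P_(m+n). *)
Definition mn_path (m n : nat) (P : seq lattice_point) : bool :=
  [&& size P == (m + n).+1,
      nth (0, 0) P 0 == (0, 0),
      nth (0, 0) P (m + n) == (m%:Z, n%:Z)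
    & sorted lattice_step P].

(* The final vertex P_(m+n) is excluded; its rank is 0, like that of P_0. *)
Definition rank_set (m n : nat) (P : seq lattice_point) : {fset int} :=
  [fset rank m n p | p in take (m + n) P]%fset.

Definition rank_sets (m n : nat) (R : {fset int}) : Prop :=
  exists2 P : seq lattice_point, mn_path m n P & R = rank_set m n P.

(* Main.v *)
Require Import Defs.
From HB Require Import structures.
From mathcomp Require Import all_boot all_order all_algebra finmap.
From mathcomp Require Import zify ring.
Import Order.TTheory GRing.Theory Num.Theory.
Local Open Scope ring_scope.

(** Modulo m + n the steps +m and -n coincide, and m is a unit.  If R is closed
    under choosing one of the two steps, the walk started at 0 therefore visits
    every residue class within m + n steps; since R has m + n elements, it has
    exactly one element in each class.  Hence the two steps never both stay in
    R, every element of R has a predecessor, and the walk is back at 0 after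
    m + n steps, which makes it the rank sequence of a lattice path.  The
    conditions on predecessors are those on successors with m and n exchanged. *)

(** The preference for [+m] is only a way to make the walk deterministic: in the setting of
    [succ_closed_unique] there is never a choice. *)
Definition rank_succ (m n : nat) (R : {fset int}) (l : int) : int :=
  if l + m%:Z \in R then l + m%:Z else l - n%:Z.

Definition succ_closed (m n : nat) (R : {fset int}) : Prop :=
  forall l : int, l \in R -> (l + m%:Z \in R) || (l - n%:Z \in R).

Lemma iter_rank_succ_in m n (R : {fset int}) i :
  0 \in R -> succ_closed m n R -> iter i (rank_succ m n R) 0 \in R.
Proof.
move=> R0 cR; elim: i => //= i IH; rewrite /rank_succ.
by case: ifP (cR _ IH) => [->|_].
Qed.

Lemma iter_rank_succ_mod m n R i :
  ((m + n)%N%:Z %| iter i (rank_succ m n R) 0 - i%:Z * m%:Z)%Z.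
Proof.
elim: i => [|i IH]; first by rewrite mul0r subr0 dvdz0.
rewrite iterS; set x := iter _ _ _ in IH *; rewrite /rank_succ.
case: ifP => _.
  by rewrite (_ : _ - _ = x - i%:Z * m%:Z) //; lia.
rewrite (_ : _ - _ = x - i%:Z * m%:Z - (m + n)%N%:Z); last by lia.
by rewrite rpredB ?dvdzz.
Qed.

(** The difference is [(i - j) * m] modulo [m + n], and [m] can be cancelled because it is coprime
    to [m + n]. *)
Lemma iter_rank_succ_eqmod m n R i j : coprime m n ->
  ((m + n)%N%:Z %| iter i (rank_succ m n R) 0 - iter j (rank_succ m n R) 0)%Z
    = (i == j %[mod m + n])%N.
Proof.
move=> co_mn; set x := iter i _ _; set y := iter j _ _.
have -> : x - y = (x - i%:Z * m%:Z) - (y - j%:Z * m%:Z)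
                  + (i%:Z - j%:Z) * m%:Z by ring.
rewrite rpredDl; last by rewrite rpredB ?iter_rank_succ_mod.
rewrite Gauss_dvdzl; last by rewrite coprimezE /= /coprime gcdnC gcdnDl.
by rewrite -eqz_mod_dvd !modz_nat eqz_nat.
Qed.

(** The first [m + n] values of the walk are pairwise incongruent, so they form a subset of [R] with
    as many elements as [R]. *)
Lemma iter_rank_succ_onto m n (R : {fset int}) l :
  coprime m n -> #|` R|%fset = (m + n)%N -> 0 \in R -> succ_closed m n R ->
  l \in R -> exists2 i, (i < m + n)%N & l = iter i (rank_succ m n R) 0.
Proof.
move=> co_mn cardR R0 cR.
pose r (i : 'I_(m + n)) := iter i (rank_succ m n R) 0.
have r_inj : injective r.
  move=> i j eq_r; apply/val_inj/eqP => /=.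
  rewrite -[X in X == _](modn_small (ltn_ord i)).
  rewrite -[X in _ == X](modn_small (ltn_ord j)).
  by rewrite -(@iter_rank_succ_eqmod m n R) // -/(r i) -/(r j) eq_r subrr dvdz0.
have /eqP defR : ([fset r i | i in 'I_(m + n)] == R)%fset.
  rewrite eqEfcard card_imfset //= -cardE card_ord cardR leqnn andbT.
  by apply/fsubsetP => _ /imfsetP[i _ ->]; rewrite /r iter_rank_succ_in.
by rewrite -{1}defR => /imfsetP[i _ ->]; exists i.
Qed.

Lemma succ_closed_residue_inj m n (R : {fset int}) :
  coprime m n -> #|` R|%fset = (m + n)%N -> 0 \in R -> succ_closed m n R ->
  {in R &, forall l l', ((m + n)%N%:Z %| l - l')%Z -> l = l'}.
Proof.
move=> co_mn cardR R0 cR l l' Rl Rl'.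
have [i lt_i ->] := iter_rank_succ_onto _ _ _ _ co_mn cardR R0 cR Rl.
have [j lt_j ->] := iter_rank_succ_onto _ _ _ _ co_mn cardR R0 cR Rl'.
by rewrite iter_rank_succ_eqmod // !modn_small // => /eqP ->.
Qed.

Lemma iter_rank_succ_period m n (R : {fset int}) i :
  coprime m n -> #|` R|%fset = (m + n)%N -> 0 \in R -> succ_closed m n R ->
  iter (i + (m + n)) (rank_succ m n R) 0 = iter i (rank_succ m n R) 0.
Proof.
move=> co_mn cardR R0 cR.
apply: (@succ_closed_residue_inj m n R); rewrite ?iter_rank_succ_in //.
by rewrite iter_rank_succ_eqmod // modnDr.
Qed.

Lemma succ_closed_unique m n (R : {fset int}) : (0 < m)%N ->
  coprime m n -> #|` R|%fset = (m + n)%N -> 0 \in R -> succ_closed m n R ->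
  forall l : int, l \in R -> (l + m%:Z \in R) (+) (l - n%:Z \in R).
Proof.
move=> m_gt0 co_mn cardR R0 cR l Rl.
have := cR _ Rl; case: (boolP (l + m%:Z \in R)) => //= Ru _.
(* The two candidates differ by [m + n], so they are congruent elements of [R] and must coincide,
   which [0 < m] forbids. *)
apply/negP => Re; suff : l + m%:Z = l - n%:Z by lia.
apply: (@succ_closed_residue_inj m n R) => //.
by rewrite (_ : _ - _ = (m + n)%N%:Z) ?dvdzz //; lia.
Qed.

(** Going once around the period gives any element of [R] a positive index in the walk, and the
    value one step earlier is the required predecessor. *)
Lemma succ_closed_pred m n (R : {fset int}) : (0 < m)%N ->
  coprime m n -> #|` R|%fset = (m + n)%N -> 0 \in R -> succ_closed m n R ->
  succ_closed n m R.
Proof.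
move=> m_gt0 co_mn cardR R0 cR l Rl.
have [i _ ->] := iter_rank_succ_onto _ _ _ _ co_mn cardR R0 cR Rl.
(* Writing [m] as a successor exposes the last step of the walk. *)
rewrite -(@iter_rank_succ_period m n) // -(prednK m_gt0) addSn addnS prednK //.
set j := (i + _)%N; rewrite iterS.
have := iter_rank_succ_in _ _ _ j R0 cR; set x := iter _ _ _ => Rx.
rewrite /rank_succ; case: ifP => _; first by rewrite addrK Rx orbT.
by rewrite subrK Rx.
Qed.

Definition path_succ (m n : nat) (R : {fset int}) (p : lattice_point) :
    lattice_point :=
  if rank m n p + m%:Z \in R then (p.1, p.2 + 1) else (p.1 + 1, p.2).

Lemma rank_path_succ m n R p :
  rank m n (path_succ m n R p) = rank_succ m n R (rank m n p).
Proof.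
rewrite /path_succ /rank_succ; case: ifP => _; rewrite /rank /=; ring.
Qed.

Lemma rank_iter_path_succ m n R i :
  rank m n (iter i (path_succ m n R) (0, 0)) = iter i (rank_succ m n R) 0.
Proof.
elim: i => [|i IH]; first by rewrite /rank /= !mulr0 subrr.
by rewrite !iterS rank_path_succ IH.
Qed.

(** Together with the rank, this sum determines the point; it serves to locate the endpoint of the
    path. *)
Lemma iter_path_succ_sum m n R i :
  (iter i (path_succ m n R) (0, 0)).1 + (iter i (path_succ m n R) (0, 0)).2
    = i%:Z.
Proof.
elim: i => //= i; set p := iter _ _ _; rewrite /path_succ.
by case: ifP => _ /=; lia.
Qed.

Lemma succ_closed_rank_sets m n (R : {fset int}) : (0 < m)%N ->
  coprime m n -> #|` R|%fset = (m + n)%N -> 0 \in R -> succ_closed m n R ->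
  rank_sets m n R.
Proof.
move=> m_gt0 co_mn cardR R0 cR.
exists (traject (path_succ m n R) (0, 0) (m + n).+1).
  rewrite /mn_path size_traject eqxx /= -[_ :: _]/(traject _ _ _.+1).
  rewrite nth_traject //; apply/andP; split; last first.
    apply: sub_path (fpath_traject _ _ _) => p _ /eqP <-.
    by rewrite /lattice_step /path_succ; case: ifP; rewrite eqxx ?orbT.
  have := iter_path_succ_sum m n R (m + n).
  have : rank m n (iter (m + n) (path_succ m n R) (0, 0)) = 0.
    by rewrite rank_iter_path_succ -[(m + n)%N]add0n iter_rank_succ_period.
  case: (iter _ _ _) => a b; rewrite /rank /= => rank0 sum_ab.
  have mn_neq0 : (m + n)%N%:Z != 0 by lia.
  (* Rank 0 gives [m * b = n * a]; adding [n * b] and using [a + b = m + n] yields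
     [(m + n) * b = (m + n) * n]. *)
  have b_n : b = n%:Z by apply: (mulfI mn_neq0); nia.
  by apply/eqP; congr pair; lia.
apply/fsetP => l; rewrite /rank_set take_traject ?leqnSn //.
apply/idP/imfsetP => [Rl | [p /= /trajectP[i lt_i ->] ->]]; last first.
  by rewrite rank_iter_path_succ iter_rank_succ_in.
have [i lt_i ->] := iter_rank_succ_onto _ _ _ _ co_mn cardR R0 cR Rl.
exists (iter i (path_succ m n R) (0, 0)); last by rewrite rank_iter_path_succ.
by apply/trajectP; exists i.
Qed.

Lemma rank_sets_succ_closed m n (R : {fset int}) :
  0 \in R -> rank_sets m n R -> succ_closed m n R.
Proof.
move=> R0 [P /and4P[/eqP szP /eqP P0 /eqP Pmn stP] defR].
(* The index [m + n] is included: that vertex is dropped from [rank_set], but its rank is 0, which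
   lies in [R]. *)
have rank_P i : (i <= m + n)%N -> rank m n (nth (0, 0) P i) \in R.
  rewrite leq_eqVlt => /predU1P[->|lt_i].
    by rewrite Pmn /rank /= mulrC subrr.
  rewrite defR; apply/imfsetP; exists (nth (0, 0) P i) => //=.
  by rewrite -(nth_take _ lt_i) mem_nth // size_take szP ltnSn.
move=> l; rewrite {1}defR => /imfsetP[p /= /(nthP (0, 0))[i]].
rewrite size_take szP ltnSn => lt_i; rewrite nth_take // => <- ->.
have := rank_P _ lt_i; move/(sortedP (0, 0)): stP => /(_ i).
rewrite szP ltnS => /(_ lt_i) /orP[] /eqP ->; rewrite /rank /=.
  by rewrite mulrDr mulr1 addrAC => ->.
by rewrite mulrDr mulr1 opprD addrA => ->; rewrite orbT.
Qed.

Theorem proposition4 (m n : nat) (hm : (0 < m)%N) (hn : (0 < n)%N)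
    (hmn : coprime m n) (R : {fset int}) (hcard : #|` R|%fset = (m + n)%N)
    (hrank : forall l : int, l \in R -> is_rank m n l) (h0 : 0 \in R) :
  [<-> rank_sets m n R;
       forall l : int, l \in R -> (l + m%:Z \in R) || (l - n%:Z \in R);
       forall l : int, l \in R -> (l + m%:Z \in R) (+) (l - n%:Z \in R);
       forall l : int, l \in R -> (l - m%:Z \in R) || (l + n%:Z \in R);
       forall l : int, l \in R -> (l - m%:Z \in R) (+) (l + n%:Z \in R)].
Proof.
have hnm : coprime n m by rewrite coprime_sym.
have hcard' : #|` R|%fset = (n + m)%N by rewrite addnC.
have orW (a b : bool) : a (+) b -> a || b by case: a.
tfae.
- exact: rank_sets_succ_closed.
- exact: succ_closed_unique.
- move=> xR l Rl; rewrite orbC; apply: (@succ_closed_pred m n) => // k Rk.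
  exact/orW/xR.
- move=> cR l Rl; rewrite addbC; apply: (@succ_closed_unique n m) => // k Rk.
  by rewrite orbC cR.
(* Reversal is an involution: with [m] and [n] exchanged, [succ_closed_pred] turns predecessors back
   into successors. *)
- move=> xR; apply: succ_closed_rank_sets => //.
  apply: succ_closed_pred => // k Rk.
  by rewrite orbC; apply/orW/xR.
Qed.
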